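(* Let $K\subset\mathbb{C}^d$ be compact and polynomial determining, let $z_0\in\mathbb{C}^d\setminus K$, and let $n\ge 0$ be an integer. Suppose $\mu_0$ is a probability measure on $K$ whose Gram matrix $G_n(\mu_0)$ is non-singular, and define $$P_n^{\mu_0,z_0}(z):=\frac{K_n^{\mu_0}(z_0,z)}{\sqrt{K_n^{\mu_0}(z_0,z_0)}}.$$ Then $\mu_0$ is an optimal prediction measure for $z_0$ relative to $K$ if and only if $P_n^{\mu_0,z_0}\in\mathbb{C}_n[z]$ is a polynomial of extremal growth at $z_0$ relative to $K$ (i.e., if and only if $\|P_n^{\mu_0,z_0}\|_K\le 1$).
   Context: $\mathbb{C}_n[z]$ is the space of complex polynomials of degree at most $n$ in $d$ complex variables, $N=\binom{n+d}{d}$ its dimension, and $\|p\|_K=\sup_{z\in K}|p(z)|$. $K$ is polynomial determining if the only polynomial $p\in\mathbb{C}[z]$ vanishing at every point of $K$ is $p=0$. $\mathcal{M}(K)$ is the set of (Borel) probability measures on $K$. Fix a basis $p_1,\dots,p_N$ of $\mathbb{C}_n[z]$ and let $\mathbf{p}(z)=(p_1(z),\dots,p_N(z))^t$. For $\mu\in\mathcal{M}(K)$ the Gram matrix is $G_n(\mu)=\left[\int_K p_i\overline{p_j}\,d\mu\right]_{1\le i,j\le N}$. When $G_n(\mu)$ is non-singular, $$K_n^\mu(w,z)=\mathbf{p}^*(w)G_n(\mu)^{-1}\mathbf{p}(z)=\sum_{k=1}^N\overline{q_k(w)}\,q_k(z)$$ for any $\mu$-orthonormal basis $q_1,\dots,q_N$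 of $\mathbb{C}_n[z]$ (where $*$ denotes conjugate transpose); on the diagonal it satisfies the variational formula $$K_n^\mu(z_0,z_0)=\sup_{p\in\mathbb{C}_n[z],\,p(z_0)\neq 0}\frac{|p(z_0)|^2}{\int_K|p|^2\,d\mu}.$$ For arbitrary $\mu\in\mathcal{M}(K)$ the quantity $K_n^\mu(z_0,z_0)\in(0,+\infty]$ is given by this variational formula, the quotient being $+\infty$ if the denominator vanishes. A measure $\mu_0\in\mathcal{M}(K)$ is an optimal prediction measure for $z_0$ relative to $K$ (also called extremal prediction measure) if $K_n^{\mu_0}(z_0,z_0)=\min_{\mu\in\mathcal{M}(K)}K_n^\mu(z_0,z_0)$. A polynomial $P\in\mathbb{C}_n[z]$ has extremal growth at $z_0$ relative to $K$ if $\|P\|_K\le1$ and $|P(z_0)|=\max_{p\in\mathbb{C}_n[z],\,\|p\|_K\le1}|p(z_0)|$. *)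

(* Defs.v *)
From HB Require Import structures.
From mathcomp Require Import all_boot all_order all_algebra.
From mathcomp Require Import all_classical all_reals all_analysis.
From mathcomp Require Import complex.
(* Only the canonical structures and coercions of mpoly are imported: its
   notations clash with those of mathcomp-analysis. *)
From mathcomp Require Import (canonicals, coercions) mpoly.

Set Implicit Arguments.
Unset Strict Implicit.
Unset Printing Implicit Defensive.

Import Order.TTheory GRing.Theory Num.Theory numFieldNormedType.Exports.
Import ComplexField.

Local Open Scope classical_set_scope.
Local Open Scope ring_scope.
Local Open Scope complex_scope.

(* R[i] receives the topology induced by its modulus; 'rV[R[i]]_d then carries
   the product topology. *)
HB.instance Definition _ (R : rcfType) :=
  NormedModule.copy R[i] (R[i] : numFieldType)^o.

Notation Cspace R d := 'rV[R[i]]_d.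
Notation Cpoly R d := (mpoly.mpoly d R[i]).
(* C^d with its Borel sigma-algebra. *)
Notation CspaceB R d := (g_sigma_algebraType (@open 'rV[R[i]]_d)).

Definition peval (R : realType) (d : nat) (p : Cpoly R d) (z : Cspace R d)
  : R[i] := mpoly.meval (fun i => z 0 i) p.

(* msize p is 1 + the total degree of p, and 0 if p = 0. *)
Definition polys_le (R : realType) (d n : nat) : set (Cpoly R d) :=
  [set p | (mpoly.msize p <= n.+1)%N].

Definition is_polys_basis (R : realType) (d n N : nat)
    (b : 'I_N -> Cpoly R d) : Prop :=
  (forall i, polys_le n (b i)) /\
  (forall q, polys_le n q ->
     exists! c : 'rV[R[i]]_N, q = \sum_(i < N) c 0 i *: b i).

(* A real supremum: meaningful when K is compact and nonempty. *)
Definition supnorm (R : realType) (d : nat) (K : set (Cspace R d))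
    (p : Cpoly R d) : R :=
  sup [set Normc.normc (peval p z) | z in K].

Definition polynomial_determining (R : realType) (d : nat)
    (K : set (Cspace R d)) : Prop :=
  forall p : Cpoly R d, (forall z, K z -> peval p z = 0) -> p = 0.

(* A Borel probability measure on K is represented by the Borel probability
   measure on C^d that it induces, which gives mass 1 to K. *)
Definition prob_on (R : realType) (d : nat) (K : set (Cspace R d)) :
    set (probability (CspaceB R d) R) :=
  [set mu | mu K = 1%E].

Definition cintegral (R : realType) (d : nat)
    (mu : probability (CspaceB R d) R) (K : set (Cspace R d))
    (f : Cspace R d -> R[i]) : R[i] :=
  (\int[mu]_(z in K) complex.Re (f z)) +i* (\int[mu]_(z in K) complex.Im (f z)).

Definition gram (R : realType) (d N : nat) (K : set (Cspace R d))
    (b : 'I_N -> Cpoly R d) (mu : probability (CspaceB R d) R) : 'M[R[i]]_N :=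
  \matrix_(i, j) cintegral mu K (fun z => peval (b i) z * conjc (peval (b j) z)).

Definition pvec (R : realType) (d N : nat) (b : 'I_N -> Cpoly R d)
    (z : Cspace R d) : 'cV[R[i]]_N :=
  \col_i peval (b i) z.

(* The row p^*(w) G_n(mu)^-1. *)
Definition kernel_coef (R : realType) (d N : nat) (K : set (Cspace R d))
    (b : 'I_N -> Cpoly R d) (mu : probability (CspaceB R d) R)
    (w : Cspace R d) : 'rV[R[i]]_N :=
  (map_mx (@conjc R) (pvec b w))^T *m invmx (gram K b mu).

Definition kernel (R : realType) (d N : nat) (K : set (Cspace R d))
    (b : 'I_N -> Cpoly R d) (mu : probability (CspaceB R d) R)
    (w z : Cspace R d) : R[i] :=
  (kernel_coef K b mu w *m pvec b z) 0 0.

Definition kernel_poly (R : realType) (d N : nat) (K : set (Cspace R d))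
    (b : 'I_N -> Cpoly R d) (mu : probability (CspaceB R d) R)
    (w : Cspace R d) : Cpoly R d :=
  \sum_(j < N) kernel_coef K b mu w 0 j *: b j.

(* The polynomial whose values are given by [peval_extremal_poly] below. *)
Definition extremal_poly (R : realType) (d N : nat) (K : set (Cspace R d))
    (b : 'I_N -> Cpoly R d) (mu : probability (CspaceB R d) R)
    (z0 : Cspace R d) : Cpoly R d :=
  (sqrtC (kernel K b mu z0 z0))^-1 *: kernel_poly K b mu z0.

Lemma peval_kernel_poly (R : realType) (d N : nat) (K : set (Cspace R d))
    (b : 'I_N -> Cpoly R d) (mu : probability (CspaceB R d) R)
    (w z : Cspace R d) :
  peval (kernel_poly K b mu w) z = kernel K b mu w z.
Proof.
rewrite /peval /kernel_poly /kernel raddf_sum mxE /=.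
by apply: eq_bigr => j _; rewrite mpoly.mevalZ [pvec b z j 0]mxE.
Qed.

Lemma peval_extremal_poly (R : realType) (d N : nat) (K : set (Cspace R d))
    (b : 'I_N -> Cpoly R d) (mu : probability (CspaceB R d) R)
    (z0 z : Cspace R d) :
  peval (extremal_poly K b mu z0) z =
  kernel K b mu z0 z / sqrtC (kernel K b mu z0 z0).
Proof.
by rewrite -peval_kernel_poly /peval /extremal_poly mpoly.mevalZ mulrC.
Qed.

Definition growth_ratio (R : realType) (d : nat) (K : set (Cspace R d))
    (mu : probability (CspaceB R d) R) (z0 : Cspace R d) (p : Cpoly R d)
    : \bar R :=
  let I := (\int[mu]_(z in K) ((Normc.normc (peval p z) ^+ 2)%:E))%E in
  if I == 0%E then +oo%E else ((Normc.normc (peval p z0) ^+ 2)%:E / I)%E.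

(* K_n^mu(z0, z0) for an arbitrary mu, by the variational formula. *)
Definition kernel_diag (R : realType) (d n : nat) (K : set (Cspace R d))
    (mu : probability (CspaceB R d) R) (z0 : Cspace R d) : \bar R :=
  ereal_sup [set growth_ratio K mu z0 p
            | p in [set p | polys_le n p /\ peval p z0 != 0]].

Definition optimal_prediction (R : realType) (d n : nat)
    (K : set (Cspace R d)) (z0 : Cspace R d)
    (mu0 : probability (CspaceB R d) R) : Prop :=
  prob_on K mu0 /\
  (forall mu, prob_on K mu ->
     (kernel_diag n K mu0 z0 <= kernel_diag n K mu z0)%E).

Definition extremal_growth (R : realType) (d n : nat)
    (K : set (Cspace R d)) (z0 : Cspace R d) (P : Cpoly R d) : Prop :=
  [/\ polys_le n P,
      supnorm K P <= 1 &
      forall p, polys_le n p -> supnorm K p <= 1 ->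
        Normc.normc (peval p z0) <= Normc.normc (peval P z0)].

(* Main.v *)
(* Let k_w be the polynomial K_n^mu0(w, .), kappa = ||k_z0||^2 = K_n^mu0(z0, z0) in
   L^2(mu0), and P = k_z0 / sqrt kappa. By the reproducing property
   <p, k_w> = p(w), the orthogonal projection of p onto the line of k_z0 is
   (p(z0) / kappa) k_z0, so Pythagoras gives |p(z0)|^2 <= kappa ||p||^2 with
   equality for p = P; hence the variational formula has the value kappa at mu0.
   If |P| <= 1 on K, then P has norm at most 1 in L^2(mu) for every mu on K, so P
   itself shows that the kernel of mu at z0 is at least kappa = |P(z0)|^2.
   If |P(z1)| > 1 for some z1 in K, moving a small part t of the mass of mu0 to z1
   raises the minimum of ||p||^2 / |p(z0)|^2, so mu0 is not optimal. *)
Require Import Defs.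
From mathcomp Require Import all_boot all_order all_algebra.
From mathcomp Require Import all_classical all_reals all_analysis.
From mathcomp Require Import measurable_realfun.
From mathcomp Require Import complex.
From mathcomp Require Import (canonicals, coercions) mpoly.
From mathcomp Require Import ring lra.

Set Implicit Arguments.
Unset Strict Implicit.
Unset Printing Implicit Defensive.

Import Order.TTheory GRing.Theory Num.Theory numFieldNormedType.Exports.

Local Open Scope classical_set_scope.
Local Open Scope ring_scope.
Local Open Scope complex_scope.

(** * Modulus, real and imaginary parts, and continuity in the complex plane *)

Lemma normc_sqrE (R : rcfType) (x : R[i]) :
  (Normc.normc x ^+ 2)%:C = x * conjc x.
Proof. by rewrite -sqr_normc rmorphXn. Qed.

Lemma normc_ge0 (R : rcfType) (x : R[i]) : 0 <= Normc.normc x.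
Proof. by case: x => s t; exact: sqrtr_ge0. Qed.

Section ComplexContinuity.
Variables (R : realType) (T : topologicalType).
Implicit Types f g : T -> R[i].

Lemma continuous_mulc f g :
  continuous f -> continuous g -> continuous (fun x => f x * g x).
Proof.
by move=> cf cg x; apply: (@cvgM _ _ _ (nbhs_filter x) f g); [exact: cf|exact: cg].
Qed.

Lemma normr_Re_le (x : R[i]) : `|complex.Re x| <= Normc.normc x.
Proof. by rewrite -lecR; exact: normc_ge_Re. Qed.

Lemma continuous_Re f : continuous f -> continuous (fun x => complex.Re (f x)).
Proof.
move=> cf x; apply/cvgrPdist_lt => /= e e0; near=> y.
rewrite -raddfB; apply: le_lt_trans (normr_Re_le _) _.
rewrite -ltcR; near: y.
by apply: (@cvgr_dist_lt _ _ _ _ (nbhs_filter x) f); [exact: cf|rewrite ltcR].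
Unshelve. all: by end_near. Qed.

Lemma continuous_conjc f : continuous f -> continuous (fun x => conjc (f x)).
Proof.
move=> cf x; apply/cvgrPdist_lt => /= e e0; near=> y.
rewrite -rmorphB normcJ; near: y.
by apply: (@cvgr_dist_lt _ _ _ _ (nbhs_filter x) f); [exact: cf|].
Unshelve. all: by end_near. Qed.

Lemma continuous_Im f : continuous f -> continuous (fun x => complex.Im (f x)).
Proof.
move=> cf; have ImRe (x : R[i]) : complex.Im x = complex.Re (x * - 'i%C).
  by case: x => s t /=; rewrite oppr0 mulr0 mulrN1 sub0r opprK.
under eq_fun do rewrite ImRe.
by apply: continuous_Re; apply: continuous_mulc; [exact: cf|exact: cst_continuous].
Qed.

End ComplexContinuity.

(** * Measurability and integrability of continuous functions on a compact set *)

Section ContinuousIntegrals.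
Variables (R : realType) (d : nat).
Implicit Types (K : set (Cspace R d)) (mu : probability (CspaceB R d) R).

Lemma peval_continuous (p : Cpoly R d) : continuous (peval p).
Proof.
rewrite /peval (_ : (fun _ => _) = fun y : Cspace R d =>
  \sum_(m <- mpoly.msupp p) mpoly.mcoeff m p * \prod_i y 0 i ^+ m i); last first.
  by apply/funext => y; rewrite mpoly.mevalE.
have addc : continuous (fun x : R[i] * R[i] => x.1 + x.2) by exact: add_continuous.
have mulc : continuous (fun x : R[i] * R[i] => x.1 * x.2) by exact: mul_continuous.
apply: (@continuous_big _ _ +%R _ _ addc) => m _.
apply: continuous_mulc; first exact: cst_continuous.
apply: (@continuous_big R[i] _ *%R _ _ mulc) => i _.
elim: (m i) => [|k IHk]; first exact: cst_continuous.
under eq_fun do rewrite exprS.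
by apply: continuous_mulc; [exact: (@coord_continuous R[i] 1 d 0 i)|exact: IHk].
Qed.

Lemma compact_measurable_Cspace K :
  compact K -> measurable (K : set (CspaceB R d)).
Proof.
move=> cK; have cl : closed K by apply: compact_closed => //; exact: norm_hausdorff.
rewrite -[K]setCK; apply: measurableC.
by apply: sub_sigma_algebra; exact: closed_openC.
Qed.

Lemma continuous_measurable_Cspace K (f : Cspace R d -> R) :
  compact K -> continuous f -> measurable_fun (K : set (CspaceB R d)) f.
Proof.
move=> cK /continuousP cf; apply: (measurability _ (RGenOpens.measurableE R)).
move=> _ [_ [a [b ->] <-]].
apply: measurableI; first exact: compact_measurable_Cspace.
by apply: sub_sigma_algebra; exact/cf/interval_open.
Qed.

Lemma continuous_integrable_Cspace mu K (f : Cspace R d -> R) :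
  compact K -> continuous f -> mu.-integrable (K : set (CspaceB R d)) (EFin \o f).
Proof.
move=> cK cf; apply: measurable_bounded_integrable.
- exact: compact_measurable_Cspace.
- by apply: le_lt_trans (probability_le1 _ _) (ltry _); exact: compact_measurable_Cspace.
- exact: continuous_measurable_Cspace.
- have /compact_bounded[M [_ mrt]] : compact [set f x | x in K].
    by apply: continuous_compact => //; exact: continuous_subspaceT.
  exists M; split; rewrite ?num_real // => x Mx y Ky.
  by apply: (mrt x Mx); exists y.
Qed.

End ContinuousIntegrals.

(** * The Hermitian form of L^2(mu) on polynomials *)

Section InnerProduct.
Variables (R : realType) (d : nat) (K : set (Cspace R d)).
Variable mu : probability (CspaceB R d) R.
Hypothesis cK : compact K.
Implicit Types (f g : Cspace R d -> R[i]) (p q : Cpoly R d).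

Let mK := compact_measurable_Cspace cK.

Let integrable_Re f : continuous f ->
  mu.-integrable K (EFin \o (fun z => complex.Re (f z))).
Proof. by move=> cf; apply: continuous_integrable_Cspace => //; exact: continuous_Re. Qed.

Let integrable_Im f : continuous f ->
  mu.-integrable K (EFin \o (fun z => complex.Im (f z))).
Proof. by move=> cf; apply: continuous_integrable_Cspace => //; exact: continuous_Im. Qed.

Lemma cintegralD f g : continuous f -> continuous g ->
  cintegral mu K (fun z => f z + g z) = cintegral mu K f + cintegral mu K g.
Proof.
move=> cf cg; rewrite /cintegral.
have ReD (x y : R[i]) : complex.Re (x + y) = complex.Re x + complex.Re y.
  by case: x y => ? ? [].
have ImD (x y : R[i]) : complex.Im (x + y) = complex.Im x + complex.Im y.
  by case: x y => ? ? [].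
under eq_Rintegral do rewrite ReD.
under [in X in _ +i* X]eq_Rintegral do rewrite ImD.
by rewrite !RintegralD //; [exact: integrable_Im|exact: integrable_Im
  |exact: integrable_Re|exact: integrable_Re].
Qed.

Lemma cintegralZ (a : R[i]) f : continuous f ->
  cintegral mu K (fun z => a * f z) = a * cintegral mu K f.
Proof.
move=> cf; rewrite /cintegral; case: a => s t.
have ReM (x : R[i]) :
    complex.Re ((s +i* t) * x) = s * complex.Re x - t * complex.Im x by case: x.
have ImM (x : R[i]) :
    complex.Im ((s +i* t) * x) = s * complex.Im x + t * complex.Re x by case: x.
under eq_Rintegral do rewrite ReM.
under [in X in _ +i* X]eq_Rintegral do rewrite ImM.
have scl u (g : Cspace R d -> R) : continuous g ->
    mu.-integrable K (EFin \o (fun z => u * g z)).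
  move=> cg; apply: continuous_integrable_Cspace => // z.
  by apply: (@cvgM _ _ _ (nbhs_filter z) (cst u) g); [exact: cst_continuous|exact: cg].
have sRe u := scl u _ (continuous_Re cf); have sIm u := scl u _ (continuous_Im cf).
rewrite (RintegralB mK (sRe s) (sIm t)) (RintegralD mK (sIm s) (sRe t)).
by rewrite !(RintegralZl _ mK (integrable_Re cf)) !(RintegralZl _ mK (integrable_Im cf)).
Qed.

Lemma cintegral_conjc f : continuous f ->
  cintegral mu K (fun z => conjc (f z)) = conjc (cintegral mu K f).
Proof.
move=> cf; rewrite /cintegral /=.
have ReJ (x : R[i]) : complex.Re (conjc x) = complex.Re x by case: x.
have ImJ (x : R[i]) : complex.Im (conjc x) = (-1) * complex.Im x.
  by case: x => ? ?; rewrite mulN1r.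
under eq_Rintegral do rewrite ReJ.
under [in X in _ +i* X]eq_Rintegral do rewrite ImJ.
by rewrite RintegralZl ?mulN1r //; exact: integrable_Im.
Qed.

(** Linear in [p], conjugate-linear in [q]; the entries of [gram] are its values on the basis. It
    may be degenerate for a general [mu]. *)
Definition ip p q : R[i] :=
  cintegral mu K (fun z => peval p z * conjc (peval q z)).

Definition normsq p : R := \int[mu]_(z in K) (Normc.normc (peval p z) ^+ 2).

Lemma continuous_pairing p q :
  continuous (fun z => peval p z * conjc (peval q z)).
Proof.
apply: continuous_mulc; first exact: peval_continuous.
by apply: continuous_conjc; exact: peval_continuous.
Qed.

Lemma pevalD p q z : peval (p + q) z = peval p z + peval q z.
Proof. exact: mpoly.mevalD. Qed.

Lemma pevalZ a p z : peval (a *: p) z = a * peval p z.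
Proof. exact: mpoly.mevalZ. Qed.

Lemma ipDl p q r : ip (p + q) r = ip p r + ip q r.
Proof.
rewrite /ip -cintegralD; [|exact: continuous_pairing..].
by congr cintegral; apply/funext => z; rewrite pevalD mulrDl.
Qed.

Lemma ipZl a p q : ip (a *: p) q = a * ip p q.
Proof.
rewrite /ip -cintegralZ; last exact: continuous_pairing.
by congr cintegral; apply/funext => z; rewrite pevalZ mulrA.
Qed.

Lemma ipC p q : ip q p = conjc (ip p q).
Proof.
rewrite /ip -cintegral_conjc; last exact: continuous_pairing.
by congr cintegral; apply/funext => z; rewrite rmorphM /= conjcK mulrC.
Qed.

Lemma ipDr p q r : ip p (q + r) = ip p q + ip p r.
Proof. by rewrite !(ipC _ p) ipDl; exact: rmorphD. Qed.

Lemma ipZr a p q : ip p (a *: q) = conjc a * ip p q.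
Proof. by rewrite !(ipC _ p) ipZl; exact: rmorphM. Qed.

(** Passing to coordinates turns identities about the form into matrix algebra with the Gram matrix,
    which is how its inverse enters the reproducing property. *)
Lemma ip_sum N (b : 'I_N -> Cpoly R d) (c e : 'rV[R[i]]_N) :
  ip (\sum_i c 0 i *: b i) (\sum_j e 0 j *: b j) =
  (c *m gram K b mu *m (map_mx (@conjc R) e)^T) 0 0.
Proof.
have ip0l q : ip 0 q = 0 by rewrite -(scale0r 0) ipZl mul0r.
have ip0r q : ip q 0 = 0 by rewrite ipC ip0l conjc0.
have suml (F : 'I_N -> Cpoly R d) q : ip (\sum_i F i) q = \sum_i ip (F i) q.
  exact: (big_morph (fun p => ip p q) (fun p r => ipDl p r q) (ip0l q)).
have sumr (F : 'I_N -> Cpoly R d) q : ip q (\sum_i F i) = \sum_i ip q (F i).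
  exact: (big_morph (ip q) (ipDr q) (ip0r q)).
rewrite sumr mxE; apply: eq_bigr => j _.
rewrite ipZr suml !mxE mulrC; congr (_ * _); apply: eq_bigr => i _.
by rewrite ipZl mxE.
Qed.

Lemma ip_normsq p : ip p p = (normsq p)%:C.
Proof.
rewrite /ip /cintegral; under eq_Rintegral do rewrite -normc_sqrE /=.
under [in X in _ +i* X]eq_Rintegral do rewrite -normc_sqrE /=.
by rewrite Rintegral_cst// mul0r.
Qed.

Lemma normsq_ge0 p : 0 <= normsq p.
Proof. by apply: Rintegral_ge0 => z _; exact: sqr_ge0. Qed.

End InnerProduct.

(** * The reproducing property and orthogonal projection onto a kernel polynomial *)

Section ReproducingKernel.
Variables (R : realType) (d n N : nat) (K : set (Cspace R d)).
Variables (b : 'I_N -> Cpoly R d) (mu : probability (CspaceB R d) R).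
Hypothesis cK : compact K.
Hypothesis bbasis : is_polys_basis n b.
Hypothesis Gunit : gram K b mu \in unitmx.
Implicit Types (p q : Cpoly R d) (w z : Cspace R d).

Local Notation kpoly := (kernel_poly K b mu).
Local Notation normsq := (normsq K mu).

Lemma gram_hermitian : (map_mx (@conjc R) (gram K b mu))^T = gram K b mu.
Proof. by apply/matrixP => i j; rewrite !mxE; exact: (esym (ipC mu cK (b j) (b i))). Qed.

(** Let c be the coordinates of [p] and G the Gram matrix. As G is Hermitian, the conjugate
    transpose of the coefficient row of [kpoly w] is G^-1 times [pvec b w]; the G of the form
    cancels it and leaves c times [pvec b w]. *)
Lemma ip_kernel_poly p w : polys_le n p -> ip K mu p (kpoly w) = peval p w.
Proof.
move=> /(proj2 bbasis)[c [-> _]]; rewrite ip_sum // /kernel_coef.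
rewrite map_mxM trmx_mul map_invmx trmx_inv gram_hermitian -map_trmx trmxK.
rewrite -mulmxA mulKVmx // -map_mx_comp map_mx_id; last by move=> x; exact: conjcK.
rewrite mxE /peval raddf_sum; apply: eq_bigr => i _ /=.
by rewrite mpoly.mevalZ mxE.
Qed.

Lemma polys_leD p q : polys_le n p -> polys_le n q -> polys_le n (p + q).
Proof.
by move=> np nq; apply: leq_trans (mpoly.msizeD_le _ _) _; rewrite geq_max; apply/andP.
Qed.

Lemma polys_leZ (a : R[i]) p : polys_le n p -> polys_le n (a *: p).
Proof. by move=> np; exact: leq_trans (mpoly.msizeZ_le _ _) np. Qed.

Lemma kernel_poly_le w : polys_le n (kpoly w).
Proof.
apply: (big_ind (polys_le n)) => [||i _]; first by rewrite /polys_le /= mpoly.msize0.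
  exact: polys_leD.
by apply: polys_leZ; exact: (proj1 bbasis).
Qed.

Lemma kernel_diagE w : Defs.kernel K b mu w w = (normsq (kpoly w))%:C.
Proof.
rewrite -peval_kernel_poly -ip_kernel_poly ?ip_normsq //.
exact: kernel_poly_le.
Qed.

(** With the coefficient t p(w), both cross terms equal -t |p(w)|^2 by the reproducing property. The
    parameter stays free: t = 1 / ||k_w||^2 gives the projection, a large t gives positivity of
    ||k_w||^2. *)
Lemma normsq_sub_kernel p w (t : R) : polys_le n p ->
  normsq (p - (t%:C * peval p w) *: kpoly w) =
  normsq p - 2 * t * Normc.normc (peval p w) ^+ 2 +
  t ^+ 2 * Normc.normc (peval p w) ^+ 2 * normsq (kpoly w).
Proof.
move=> np; apply: complexI; rewrite -(ip_normsq mu cK) -scaleNr.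
rewrite (ipDl mu cK) !(ipDr mu cK) !(ipZl mu cK) !(ipZr mu cK) (ipC mu cK p (kpoly w)).
rewrite ip_kernel_poly // !(ip_normsq mu cK).
move: (Normc.normc _ ^+ 2) (normc_sqrE (peval p w)) => s sE.
rewrite !(rmorphD, rmorphB, rmorphM, rmorphXn, rmorphN) /= sE.
have -> : t -i* 0 = t%:C by rewrite oppr0.
rewrite rmorph1.
(* Here y' stands for the conjugate of x' = p(w), treated as an independent variable, so that only a
   polynomial identity remains. *)
have rearr (C : comPzRingType) (P' u' x' y' k' : C) :
    P' + - (u' * y') * x' + (- (u' * x') * y' + - (u' * x') * (- (u' * y') * k')) =
    P' - (1 + 1) * u' * (x' * y') + u' * u' * (x' * y') * k' by ring.
exact: (rearr _ (normsq p)%:C t%:C (peval p w) (conjc (peval p w)) (normsq (kpoly w))%:C).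
Qed.

(** If ||k_w|| were 0, then ||1 - t k_w||^2 would equal ||1||^2 - 2 t, which is negative at t =
    ||1||^2 + 1. The constant 1 is a legitimate test polynomial for every [n]. *)
Lemma normsq_kernel_gt0 w : 0 < normsq (kpoly w).
Proof.
have n1 : polys_le n (1 : Cpoly R d) by rewrite /polys_le /= mpoly.msize1.
rewrite lt_neqAle normsq_ge0 // andbT; apply/negP => /eqP k0.
have := normsq_ge0 K mu (1 - ((normsq 1 + 1)%:C * peval 1 w) *: kpoly w).
rewrite normsq_sub_kernel // -k0 /peval mpoly.meval1 Normc.normc1.
have := normsq_ge0 K mu 1; move: (normsq 1) => s s0.
lra.
Qed.

Lemma normsq_pythagoras p w : polys_le n p ->
  normsq p = Normc.normc (peval p w) ^+ 2 / normsq (kpoly w) +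
    normsq (p - ((normsq (kpoly w))^-1%:C * peval p w) *: kpoly w).
Proof.
move=> np; rewrite normsq_sub_kernel //.
have arith (P x k : R) : 0 < k ->
    P = x / k + (P - 2 * k^-1 * x + k^-1 ^+ 2 * x * k).
  by move=> k0; field; rewrite gt_eqF.
exact: arith (normsq_kernel_gt0 w).
Qed.

Lemma normc_peval_le p w : polys_le n p ->
  Normc.normc (peval p w) ^+ 2 <= normsq (kpoly w) * normsq p.
Proof.
move=> np; rewrite -ler_pdivrMl ?normsq_kernel_gt0 // mulrC.
by rewrite (normsq_pythagoras w np) lerDl normsq_ge0.
Qed.

End ReproducingKernel.

(** * Bounds from the variational formula, mixtures with a point mass, and the sup norm *)

Section KernelDiag.
Variables (R : realType) (d n : nat) (K : set (Cspace R d)).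
Hypothesis cK : compact K.
Implicit Types (mu : probability (CspaceB R d) R) (p : Cpoly R d).
Implicit Types (w z : Cspace R d).

Lemma continuous_normc_sqr p :
  continuous (fun z => Normc.normc (peval p z) ^+ 2).
Proof.
have -> : (fun z => Normc.normc (peval p z) ^+ 2) =
    fun z => complex.Re (peval p z * conjc (peval p z)).
  by apply/funext => z; rewrite -normc_sqrE.
by apply: continuous_Re; exact: continuous_pairing.
Qed.

Lemma integral_normc_sqr mu p :
  (\int[mu]_(z in K) ((Normc.normc (peval p z) ^+ 2)%:E))%E = (normsq K mu p)%:E.
Proof.
rewrite /normsq /Rintegral fineK //; apply: integrable_fin_num.
  exact: compact_measurable_Cspace.
by apply: continuous_integrable_Cspace => //; exact: continuous_normc_sqr.
Qed.

Lemma growth_ratioE mu z p : growth_ratio K mu z p =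
  if normsq K mu p == 0 then +oo%E
  else (Normc.normc (peval p z) ^+ 2 / normsq K mu p)%:E.
Proof.
rewrite /growth_ratio integral_normc_sqr eqe; case: eqP => // /eqP p0.
by rewrite inver (negbTE p0).
Qed.

Lemma normc_sqr_gt0 (x : R[i]) : x != 0 -> 0 < Normc.normc x ^+ 2.
Proof. by move=> x0; rewrite -ltcR normc_sqrE -sqr_normc exprn_gt0 // normr_gt0. Qed.

Lemma kernel_diag_le mu z (M : R) :
  (forall p, polys_le n p -> Normc.normc (peval p z) ^+ 2 <= M * normsq K mu p) ->
  (kernel_diag n K mu z <= M%:E)%E.
Proof.
move=> pM; apply: ge_ereal_sup => _ [p [np pz0] <-].
have := pM _ np; have := normc_sqr_gt0 pz0; rewrite growth_ratioE.
(* A null denominator would make the ratio +oo, but the assumed bound then gives |p(z)|^2 <= 0,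
   against p(z) <> 0. *)
have [->|p0] := eqVneq (normsq K mu p) 0.
  by rewrite mulr0 => /lt_le_trans h /h; rewrite ltxx.
by move=> _; rewrite lee_fin ler_pdivrMr // lt_neqAle eq_sym p0 normsq_ge0.
Qed.

Lemma le_kernel_diag mu z (M : R) p :
  polys_le n p -> peval p z != 0 ->
  M * normsq K mu p <= Normc.normc (peval p z) ^+ 2 ->
  (M%:E <= kernel_diag n K mu z)%E.
Proof.
move=> np pz0 pM; apply: (@le_trans _ _ (growth_ratio K mu z p)); last first.
  by apply: ereal_sup_ubound; exists p.
rewrite growth_ratioE; case: eqP => [_|/eqP p0]; first exact: leey.
by rewrite lee_fin ler_pdivlMr // lt_neqAle eq_sym p0 normsq_ge0.
Qed.

(** The measure is (1 - t) mu + t delta_w, the perturbation used against optimality. *)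
Lemma prob_mix_dirac mu w (t : R) : prob_on K mu -> K w -> 0 <= t <= 1 ->
  exists2 nu : probability (CspaceB R d) R, prob_on K nu &
    forall p, normsq K nu p =
      (1 - t) * normsq K mu p + t * Normc.normc (peval p w) ^+ 2.
Proof.
move=> muK Kw /andP[t0 t1]; have mK := compact_measurable_Cspace cK.
have s0 : 0 <= 1 - t by rewrite subr_ge0.
pose m1 := mscale (NngNum s0) mu.
pose m2 := mscale (NngNum t0) (@dirac _ (CspaceB R d) w R).
pose m : {measure set (CspaceB R d) -> \bar R} := measure_add m1 m2.
have mE A : m A = ((1 - t)%:E * mu A + t%:E * @dirac _ (CspaceB R d) w R A)%E.
  exact: measure_addE.
have mT : m setT = 1%E.
  by rewrite mE probability_setT diracT !mule1 -EFinD subrK.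
(* [mnormalize] only supplies the probability structure: [m] already has mass 1, so neither the
   rescaling nor the fallback [mu] changes it. *)
have nuE : mnormalize m mu = m :> (set _ -> \bar R).
  apply/funext => A; rewrite /mnormalize mT onee_eq0 /=.
  by rewrite invr1 mule1.
exists (mnormalize m mu) => [|p].
  rewrite /prob_on /= nuE mE; have -> : mu K = 1%E by exact: muK.
  by rewrite diracE mem_set // !mule1 -EFinD subrK.
apply: EFin_inj; rewrite -integral_normc_sqr.
rewrite (eq_measure_integral m) => [|A _ _]; last exact: (congr1 (@^~ A) nuE).
have /measurable_EFinP mf :=
  continuous_measurable_Cspace cK (@continuous_normc_sqr p).
have f0 z : K z -> (0 <= (Normc.normc (peval p z) ^+ 2)%:E)%E.
  by move=> _; rewrite lee_fin sqr_ge0.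
rewrite ge0_integral_measure_add // !ge0_integral_mscale // integral_dirac //.
by rewrite integral_normc_sqr diracE mem_set // mul1e.
Qed.

Lemma supnorm_leP p (M : R) : K !=set0 ->
  supnorm K p <= M <-> (forall z, K z -> Normc.normc (peval p z) <= M).
Proof.
move=> [z0 Kz0]; split => [pM z Kz|pM].
  apply: le_trans pM; apply: ub_le_sup; last by exists z.
  have /compact_bounded[M0 [_ hM]] :
      compact [set Normc.normc (peval p z) ^+ 2 | z in K].
    apply: continuous_compact => //; apply: continuous_subspaceT.
    exact: continuous_normc_sqr.
  (* Compactness bounds the squares, s^2 <= M0 + 1, the bound being available only strictly above
     M0; then s <= s^2 + 1 costs the second 1. *)
  exists (M0 + 1 + 1) => _ [y Ky <-].
  have := hM (M0 + 1) _ (Normc.normc (peval p y) ^+ 2).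
  rewrite ltrDl ltr01 => /(_ isT).
  have yK : [set Normc.normc (peval p z) ^+ 2 | z in K] (Normc.normc (peval p y) ^+ 2).
    by exists y.
  move=> /(_ yK) /(le_trans (ler_norm _)).
  move: (Normc.normc _) => s; nra.
apply: ge_sup; first by exists (Normc.normc (peval p z0)), z0.
by move=> _ [y Ky <-]; exact: pM.
Qed.

Lemma normsq_le1 mu p :
  K !=set0 -> prob_on K mu -> supnorm K p <= 1 -> normsq K mu p <= 1.
Proof.
move=> K0 muK /(supnorm_leP _ _ K0) p1.
have mK := compact_measurable_Cspace cK.
have -> : 1 = \int[mu]_(z in K) (1 : R).
  by rewrite Rintegral_cst // mul1r; exact: (esym (congr1 fine muK)).
apply: le_Rintegral => //.
- by apply: continuous_integrable_Cspace => //; exact: continuous_normc_sqr.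
- by apply: continuous_integrable_Cspace => //; exact: cst_continuous.
- by move=> z Kz; rewrite expr_le1 // ?p1 // normc_ge0.
Qed.

End KernelDiag.

(* Young's bound (y + v)^2 <= (1 + eta) (y^2 + v^2 / eta), with eta
   so small that B / (1 + eta) > 1; then t makes the two terms in rho cancel. *)
Lemma mixture_gain (R : realFieldType) (B k : R) : 1 < B -> 0 < k ->
  exists t g : R, [/\ 0 <= t <= 1, 1 < g &
    forall A rho y v : R, 0 <= y -> 0 <= v ->
      A * B <= (y + v) ^+ 2 -> v ^+ 2 <= k * rho ->
      g * A <= (1 - t) * (A + rho) + t * y ^+ 2].
Proof.
move=> B1 k0; pose eta := (B - 1) / 2.
have eta0 : 0 < eta by rewrite /eta; lra.
have ek0 : 0 < eta + k by rewrite addr_gt0.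
have eta1 : 0 < 1 + eta by rewrite addr_gt0.
(* This t solves (1 - t) rho = t k rho / eta, and g = (1 - t) + t B / (1 + eta) is the coefficient
   of A that is left. *)
exists (eta / (eta + k)), (1 + eta / (eta + k) * (B / (1 + eta) - 1)); split.
- by rewrite divr_ge0 ?(ltW ek0) ?(ltW eta0) //= ler_pdivrMr // mul1r lerDl ltW.
- rewrite ltrDl; apply: mulr_gt0; first exact: divr_gt0.
  by rewrite subr_gt0 ltr_pdivlMr // mul1r /eta; lra.
move=> A rho y v y0 v0 AB vk.
have young : A * B / (1 + eta) <= y ^+ 2 + v ^+ 2 / eta.
  rewrite ler_pdivrMr //; apply: le_trans AB _.
  have -> : (y ^+ 2 + v ^+ 2 / eta) * (1 + eta) =
      (y + v) ^+ 2 + (eta * y - v) ^+ 2 / eta by field; rewrite gt_eqF.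
  by rewrite lerDl divr_ge0 ?sqr_ge0 // ltW.
have vr : v ^+ 2 / eta <= k * rho / eta by rewrite ler_pM2r ?invr_gt0.
rewrite -subr_ge0.
have -> : (1 - eta / (eta + k)) * (A + rho) + eta / (eta + k) * y ^+ 2 -
    (1 + eta / (eta + k) * (B / (1 + eta) - 1)) * A =
    eta / (eta + k) * (k * rho / eta + y ^+ 2 - A * B / (1 + eta)).
  by field; rewrite !gt_eqF.
apply: mulr_ge0; first by rewrite divr_ge0 ?ltW.
lra.
Qed.

(** * Extremal growth and optimality of the measure *)

Section ExtremalPoly.
Variables (R : realType) (d n N : nat) (K : set (Cspace R d)).
Variables (b : 'I_N -> Cpoly R d) (mu0 : probability (CspaceB R d) R).
Variable z0 : Cspace R d.
Hypothesis cK : compact K.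
Hypothesis K0 : K !=set0.
Hypothesis bbasis : is_polys_basis n b.
Hypothesis mu0K : prob_on K mu0.
Hypothesis Gunit : gram K b mu0 \in unitmx.

Local Notation kpoly := (kernel_poly K b mu0).
Local Notation P := (extremal_poly K b mu0 z0).
Local Notation kappa w := (normsq K mu0 (kpoly w)).

Let kappa_gt0 w : 0 < kappa w := normsq_kernel_gt0 cK bbasis Gunit w.

(** Squaring removes [sqrtC], because the kernel at (z0, z0) is the positive real [kappa z0]. *)
Lemma normc_extremal_poly z :
  Normc.normc (peval P z) ^+ 2 = Normc.normc (peval (kpoly z0) z) ^+ 2 / kappa z0.
Proof.
rewrite peval_extremal_poly -peval_kernel_poly (kernel_diagE cK bbasis Gunit).
rewrite Normc.normcM Normc.normcV exprMn exprVn; congr (_ / _).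
rewrite expr2 -Normc.normcM -expr2 sqrtCK /= expr0n addr0 sqrtr_sqr.
by rewrite ger0_norm // ltW.
Qed.

Lemma normc_kernel_poly_diag :
  Normc.normc (peval (kpoly z0) z0) ^+ 2 = kappa z0 ^+ 2.
Proof.
rewrite peval_kernel_poly (kernel_diagE cK bbasis Gunit) /= expr0n addr0.
by rewrite sqrtr_sqr ger0_norm // ltW.
Qed.

Lemma normc_extremal_poly_diag : Normc.normc (peval P z0) ^+ 2 = kappa z0.
Proof.
rewrite normc_extremal_poly normc_kernel_poly_diag expr2 mulfK //.
by rewrite gt_eqF.
Qed.

Lemma extremal_poly_le : polys_le n P.
Proof. by apply: polys_leZ; exact: kernel_poly_le. Qed.

Lemma kernel_diag_eq : kernel_diag n K mu0 z0 = (kappa z0)%:E.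
Proof.
apply/eqP; rewrite eq_le; apply/andP; split.
  by apply: kernel_diag_le => // p np; exact: normc_peval_le np.
apply: (le_kernel_diag cK (p := kpoly z0)).
- exact: kernel_poly_le.
- rewrite peval_kernel_poly (kernel_diagE cK bbasis Gunit) -(rmorph0 (real_complex R)).
  by rewrite (inj_eq (@complexI R)) gt_eqF.
- by rewrite normc_kernel_poly_diag expr2.
Qed.

(** The maximality clause comes for free: if |p| <= 1 on K, then |p(z0)|^2 <= kappa ||p||^2 <= kappa
    = |P(z0)|^2, since [mu0] has mass 1. *)
Lemma extremal_growth_supnorm :
  extremal_growth n K z0 P <-> supnorm K P <= 1.
Proof.
split => [[]//|P1]; split => // [|p np p1]; first exact: extremal_poly_le.
rewrite -ler_sqr ?nnegrE ?normc_ge0 // normc_extremal_poly_diag.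
apply: le_trans (normc_peval_le cK bbasis Gunit z0 np) _.
by rewrite ler_piMr ?(ltW (kappa_gt0 _)) // normsq_le1.
Qed.

Lemma supnorm_optimal : supnorm K P <= 1 -> optimal_prediction n K z0 mu0.
Proof.
move=> P1; split => // mu muK; rewrite kernel_diag_eq.
apply: (le_kernel_diag cK (p := P)); first exact: extremal_poly_le.
  apply/eqP => Pz0; have := kappa_gt0 z0.
  by rewrite -normc_extremal_poly_diag Pz0 Normc.normc0 expr0n ltxx.
by rewrite normc_extremal_poly_diag ler_piMr ?(ltW (kappa_gt0 _)) // normsq_le1.
Qed.

Lemma optimal_supnorm : optimal_prediction n K z0 mu0 -> supnorm K P <= 1.
Proof.
move=> [_ opt]; apply/(supnorm_leP cK _ _ K0) => z1 Kz1.
rewrite leNgt; apply/negP => Pz1.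
have B1 : 1 < Normc.normc (peval P z1) ^+ 2 by rewrite exprn_egt1.
have [t [g [t01 g1 gain]]] := mixture_gain B1 (kappa_gt0 z1).
have g0 := lt_trans ltr01 g1.
have [nu nuK nuE] := prob_mix_dirac cK mu0K Kz1 t01.
(* As g > 1, this puts the kernel of [nu] strictly below that of [mu0]. *)
have : (kernel_diag n K nu z0 <= (kappa z0 / g)%:E)%E.
  apply: kernel_diag_le => // p np; rewrite nuE.
  (* The decomposition p = c k_z0 + r is orthogonal in L^2(mu0); its first part has squared norm
     |p(z0)|^2 / kappa. *)
  pose c := (kappa z0)^-1%:C * peval p z0; pose r := p - c *: kpoly z0.
  have nr : polys_le n r.
    by apply: polys_leD => //; rewrite -scaleNr; apply: polys_leZ; exact: kernel_poly_le.
  have rz1 := normc_peval_le cK bbasis Gunit z1 nr.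
  have cE : Normc.normc (c * peval (kpoly z0) z1) ^+ 2 =
      Normc.normc (peval p z0) ^+ 2 / kappa z0 * Normc.normc (peval P z1) ^+ 2.
    have arith (k x y : R) : 0 < k -> k ^- 2 * x * y = x / k * (y / k).
      by move=> k0; field; rewrite gt_eqF.
    rewrite normc_extremal_poly 2!Normc.normcM 2!exprMn.
    have -> : Normc.normc (kappa z0)^-1%:C ^+ 2 = (kappa z0) ^- 2.
      by rewrite /= expr0n addr0 sqrtr_sqr -exprVn real_normK // num_real.
    exact: arith (kappa_gt0 z0).
  have tri : Normc.normc (c * peval (kpoly z0) z1) <=
      Normc.normc (peval p z1) + Normc.normc (peval r z1).
    have -> : c * peval (kpoly z0) z1 = peval p z1 + - peval r z1.
      by rewrite /r -scaleNr pevalD pevalZ mulNr opprB addrC subrK.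
    by rewrite -(normcN (peval r z1)); exact: le_normcD.
  rewrite (normsq_pythagoras cK bbasis Gunit z0 np).
  have arith (k x W : R) : 0 < k -> g * (x / k) <= W -> x <= k / g * W.
    move=> k0; rewrite -(ler_pM2l (divr_gt0 k0 g0)); apply: le_trans.
    by rewrite le_eqVlt; apply/orP; left; apply/eqP; field; rewrite !gt_eqF.
  apply: arith (kappa_gt0 z0) _.
  (* Here A = |p(z0)|^2 / kappa, rho = ||r||^2, y = |p(z1)| and v = |r(z1)|, with B = |P(z1)|^2 and
     k = [kappa z1]. The bound on v is the reproducing inequality at z1; the bound on A B is the
     triangle inequality [tri]. *)
  apply: (gain _ _ _ _ (normc_ge0 _) (normc_ge0 _) _ rz1).
  by rewrite -cE ler_sqr ?nnegrE ?addr_ge0 ?normc_ge0.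
move=> /(le_trans (opt _ nuK)); rewrite kernel_diag_eq lee_fin.
by rewrite ler_pdivlMr // ger_pMr // leNgt g1.
Qed.

End ExtremalPoly.

Theorem theorem2p2 (R : realType) (d n : nat) (K : set (Cspace R d))
    (z0 : Cspace R d) (b : 'I_('C(n + d, d)) -> Cpoly R d)
    (mu0 : probability (CspaceB R d) R)
    (Kcompact : compact K)
    (Kdet : polynomial_determining K)
    (z0K : ~ K z0)
    (bbasis : is_polys_basis n b)
    (mu0K : prob_on K mu0)
    (Gmu0 : gram K b mu0 \in unitmx) :
  (optimal_prediction n K z0 mu0 <->
     extremal_growth n K z0 (extremal_poly K b mu0 z0)) /\
  (extremal_growth n K z0 (extremal_poly K b mu0 z0) <->
     (supnorm K (extremal_poly K b mu0 z0) <= 1)%R).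
Proof.
(* An empty K would have mass 0, not 1; nonemptiness makes the real supremum in [supnorm]
   meaningful. *)
have K0 : K !=set0.
  apply/set0P/negP => /eqP KE; have : 0%E = 1%E :> \bar R.
    by rewrite -(measure0 mu0) -KE.
  by move=> /eqP; rewrite eqe eq_sym oner_eq0.
have growth := extremal_growth_supnorm z0 Kcompact K0 bbasis mu0K Gmu0.
split; last exact: growth.
split => [opt|/growth]; first by apply/growth; exact: optimal_supnorm opt.
exact: supnorm_optimal.
Qed.
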